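(* Let $X$ be an infinite-dimensional real Banach space. Suppose that there is $\delta\in(0,1/2)$ such that $\Phi_X(\delta)=\sqrt{2\delta}$ (or, equivalently, $\Phi_X^S(\delta)=\sqrt{2\delta}$). Then $X^*$ (and hence also $X$) contains almost isometric copies of the real space $\ell_\infty^{(2)}$.
   Context: For a (real or complex) Banach space $X\neq\{0\}$, $B_X$ and $S_X$ denote its closed unit ball and unit sphere, $X^*$ its topological dual, and $\Pi(X):=\{(x,x^* )\in X\times X^* : \|x\|=\|x^*\|=x^*(x)=1\}$. The Bishop-Phelps-Bollobás modulus $\Phi_X:(0,2)\to[0,\infty)$ is defined as follows: $\Phi_X(\delta)$ is the infimum of those $\varepsilon>0$ such that for every $(x,x^* )\in B_X\times B_{X^*}$ with $\operatorname{Re} x^*(x)>1-\delta$ there is $(y,y^* )\in\Pi(X)$ with $\|x-y\|<\varepsilon$ and $\|x^*-y^*\|<\varepsilon$. The spherical Bishop-Phelps-Bollobás modulus $\Phi_X^S:(0,2)\to[0,\infty)$ is defined in the same way with $B_X\times B_{X^*}$ replaced by $S_X\times S_{X^*}$. The real space $\ell_\infty^{(2)}$ is $\mathbb{R}^2$ with the maximum norm. A Banach space $X$ contains almost isometric copies of a Banach space $E$ if for every $\varepsilon>0$ there are a subspace $E_\varepsilon\subset X$ and a bijective linear operator $T:E\to E_\varepsilon$ with $\|T\|<1+\varepsilon$ and $\|T^{-1}\|<1+\varepsilon$. *)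

(* Defs.v *)
From HB Require Import structures.
From mathcomp Require Import all_boot all_order all_algebra.
From mathcomp Require Import all_classical all_reals all_analysis.

Set Implicit Arguments.
Unset Strict Implicit.
Unset Printing Implicit Defensive.

Import Order.TTheory GRing.Theory Num.Theory.
Import numFieldNormedType.Exports.

Local Open Scope classical_set_scope.
Local Open Scope ring_scope.

Definition unit_ball (R : realType) (V : normedModType R) : set V :=
  [set x | `|x| <= 1].

Definition unit_sphere (R : realType) (V : normedModType R) : set V :=
  [set x | `|x| = 1].

Arguments unit_ball {R} V.
Arguments unit_sphere {R} V.

(* Operator norm of (the restriction to a subspace D of) a linear map f; it is
   extended-real valued so that an unbounded f gets +oo and not a junk value. *)
Definition opnorm (R : realType) (V W : normedModType R) (D : set V)
    (f : V -> W) : \bar R :=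
  ereal_sup [set (`|f x|)%:E | x in D `&` unit_ball V].

Section Dual.
Variables (R : realType) (X : normedModType R).

Definition dual_pred : {pred X -> R^o} :=
  fun f => `[< linear f /\ continuous f >].

Record topdual := TopDual {
  dual_fun :> X -> R^o ;
  _ : dual_fun \in dual_pred }.

HB.instance Definition _ := [isSub for dual_fun].
HB.instance Definition _ := [Choice of topdual by <:].

Lemma dual_pred_submod : submod_closed dual_pred.
Proof.
split=> [|a f g /asboolP[lf cf] /asboolP[lg cg]]; apply/asboolP; split.
- by move=> a x y /=; rewrite scaler0 addr0.
- exact: cst_continuous.
- move=> b x y; rewrite -[LHS]/(a *: f (b *: x + y) + g (b *: x + y)) lf lg.
  by rewrite !scalerDr addrACA !scalerA (mulrC a b).
- move=> x; apply: cvgD (cg x).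
  exact: (@cvgZl_tmp _ R^o _ _ _ a f _ (cf x)).
Qed.

HB.instance Definition _ :=
  GRing.isSubmodClosed.Build R (X -> R^o) dual_pred dual_pred_submod.
HB.instance Definition _ := [SubChoice_isSubLmodule of topdual by <:].

Implicit Types f g : topdual.

Lemma dual_linear f : linear f.
Proof. by case: f => f /= /asboolP[]. Qed.

Lemma dual_continuous f : continuous f.
Proof. by case: f => f /= /asboolP[]. Qed.

HB.instance Definition _ f :=
  GRing.isLinear.Build R X R^o *:%R f (@dual_linear f).

Lemma dual_addE f g x : (f + g) x = f x + g x.
Proof. by []. Qed.

Lemma dual_scaleE (a : R) f x : (a *: f) x = a * f x.
Proof. by []. Qed.

Definition dual_norm f : R := fine (opnorm [set: X] f).

Lemma dual_opnorm_fin f : opnorm [set: X] f \is a fin_num.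
Proof.
have [M fM] : exists M, forall x, `|x| <= 1 -> `|f x| <= M.
  have /bounded_funP/(_ 1)//: bounded_near f (nbhs (0 : X)).
  exact/linear_bounded_continuous/dual_continuous.
rewrite fin_real//; apply/andP; split.
  apply: (@lt_le_trans _ _ (`|f 0|%:E)); first exact: ltNyr.
  by apply: ereal_sup_ubound; exists 0 => //; split=> //; rewrite /unit_ball/= normr0.
apply: (@le_lt_trans _ _ M%:E); last exact: ltry.
by apply: ge_ereal_sup => _ [x [_ x1] <-]; rewrite lee_fin; exact: fM.
Qed.

Lemma dual_norm_ball f x : `|x| <= 1 -> `|f x| <= dual_norm f.
Proof.
move=> x1; rewrite -lee_fin fineK ?dual_opnorm_fin//.
by apply: ereal_sup_ubound; exists x.
Qed.

Lemma dual_norm_le f M : (forall x, `|x| <= 1 -> `|f x| <= M) -> dual_norm f <= M.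
Proof.
move=> fM; rewrite -lee_fin fineK ?dual_opnorm_fin//.
by apply: ge_ereal_sup => _ [x [_ x1] <-]; rewrite lee_fin; exact: fM.
Qed.

Lemma dual_norm_ge0 f : 0 <= dual_norm f.
Proof. by apply: le_trans (dual_norm_ball f (x := 0) _); rewrite ?normr0. Qed.

Lemma dual_norm_ub f x : `|f x| <= dual_norm f * `|x|.
Proof.
have [->|x0] := eqVneq x 0; first by rewrite linear0 !normr0 mulr0.
rewrite -ler_pdivrMr ?normr_gt0// mulrC.
have := @dual_norm_ball f (`|x|^-1 *: x).
rewrite linearZ/= !normrZ normfV normr_id mulVf ?normr_eq0//.
exact.
Qed.

Lemma dual_normD f g : dual_norm (f + g) <= dual_norm f + dual_norm g.
Proof.
apply: dual_norm_le => x x1; rewrite dual_addE.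
by rewrite (le_trans (ler_normD _ _))// lerD// dual_norm_ball.
Qed.

Lemma dual_normZ (a : R) f : dual_norm (a *: f) = `|a| * dual_norm f.
Proof.
apply/eqP; rewrite eq_le; apply/andP; split.
  by apply: dual_norm_le => x x1; rewrite dual_scaleE normrM ler_wpM2l// dual_norm_ball.
have [->|a0] := eqVneq a 0; first by rewrite normr0 mul0r dual_norm_ge0.
rewrite -ler_pdivlMl ?normr_gt0//; apply: dual_norm_le => x x1.
by rewrite ler_pdivlMl ?normr_gt0// -normrM -dual_scaleE dual_norm_ball.
Qed.

Lemma dual_norm0_eq0 f : dual_norm f = 0 -> f = 0.
Proof.
move=> f0; apply/val_inj/funext => x; apply/eqP.
by rewrite -normr_le0 (le_trans (dual_norm_ub f x))// f0 mul0r.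
Qed.

HB.instance Definition _ :=
  Lmodule_isNormed.Build R topdual dual_normD dual_normZ dual_norm0_eq0.

End Dual.

Section BishopPhelpsBollobas.
Variables (R : realType) (X : normedModType R).

Definition norming_pairs : set (X * topdual X) :=
  [set p : X * topdual X | [/\ `|p.1| = 1, `|p.2| = 1 & p.2 p.1 = 1]].

Definition BPB_modulus_on (D : set (X * topdual X)) (delta : R) : R :=
  inf [set eps | 0 < eps /\
    forall (x : X) (f : topdual X), D (x, f) -> 1 - delta < f x ->
      exists (y : X) (g : topdual X),
        [/\ norming_pairs (y, g), `|x - y| < eps & `|f - g| < eps]].

Definition BPB_modulus : R -> R :=
  BPB_modulus_on (unit_ball X `*` unit_ball (topdual X)).

Definition spherical_BPB_modulus : R -> R :=
  BPB_modulus_on (unit_sphere X `*` unit_sphere (topdual X)).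

End BishopPhelpsBollobas.

Arguments norming_pairs {R} X.
Arguments BPB_modulus {R} X delta.
Arguments spherical_BPB_modulus {R} X delta.

Definition infinite_dimensional (R : realType) (X : normedModType R) : Prop :=
  ~ exists (n : nat) (e : 'I_n -> X),
      forall x, exists c : 'I_n -> R, x = \sum_(i < n) c i *: e i.

(* Y is the subspace E_eps, T : E -> Y the linear bijection and S : Y -> E its
   inverse (S is only relevant on Y). *)
Definition almost_isometric_copies (R : realType) (X E : normedModType R) :
    Prop :=
  forall eps : R, 0 < eps ->
    exists (Y : set X) (T : {linear E -> X}) (S : X -> E),
      [/\ submod_closed [in Y],
          set_bij [set: E] Y T,
          cancel T S,
          (opnorm [set: E] T < (1 + eps)%:E)%E &
          (opnorm Y S < (1 + eps)%:E)%E].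

Arguments infinite_dimensional {R} X.
Arguments almost_isometric_copies {R} X E.

(* Main.v *)
Require Import Defs.
From HB Require Import structures.
From mathcomp Require Import all_boot all_order all_algebra.
From mathcomp Require Import all_classical all_reals all_analysis.
From mathcomp Require Import ring lra.
Import Order.TTheory GRing.Theory Num.Theory.
Import numFieldNormedType.Exports.
Local Open Scope classical_set_scope.
Local Open Scope ring_scope.

(* Put eps = sqrt (2 delta) < 1. Ekeland's principle and Hahn-Banach give the
   Bishop-Phelps theorem: for unit x, f and 0 < k < 1 there are a unit y and a
   functional g attaining its norm at y with |x - y| <= (1 - f x) / k and
   |f - g| <= k. Then |f - g/|g|| <= 2k, and k = eps/2 yields Phi <= eps. When
   delta < 1/2, pairs (x, f) for which this bound is nearly optimal are nearly
   normalised, so they may be taken on the spheres. For such a pair,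
   |f - g/|g|| ~ 2k forces |g| ~ 1 - k; then a = (f - g)/k and b = g/|g| satisfy
   f - b ~ k (a - b) and f ~ k a + (1 - k) b, whence |a - b| ~ 2 and, as |f| = 1,
   |a + b| ~ 2. So (a + b)/2 and (a - b)/2 span an almost isometric copy of
   l_infty^2 in the dual; vectors x, y of X almost norming (a + b)/2 and
   (a - b)/2 give (x + y)/2 and (x - y)/2, which do the same in X. *)

Set Implicit Arguments.
Unset Strict Implicit.
Unset Printing Implicit Defensive.

(** * Ekeland's variational principle *)

(** Each [u n.+1] nearly maximises [f] on the set [S (u n)] of points dominating [u n]. These closed
    sets are nested, with diameters tending to 0, and their common point y is dominated only by
    itself. *)
Lemma ekeland_maximum (R : realType) (V : completeNormedModType R) (A : set V)
    (f : V -> R) (M k : R) (x : V) :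
    closed A -> continuous f -> (forall z, A z -> f z <= M) -> 0 < k -> A x ->
  exists y, [/\ A y, f x + k * `|x - y| <= f y &
    forall z, A z -> f z <= f y + k * `|z - y|].
Proof.
move=> Acl fcont fM k0 Ax.
pose S u := [set z | A z /\ f u + k * `|u - z| <= f z].
have S_refl u : A u -> S u u by move=> Au; split=> //; rewrite subrr normr0; lra.
have S_trans u v w : S u v -> S v w -> S u w.
  move=> [_ uv] [Aw vw]; split => //.
  have : k * `|u - w| <= k * (`|u - v| + `|v - w|).
    by rewrite ler_wpM2l ?(ltW k0)// ler_distD.
  lra.
(* The pair carries the stage n, whose tolerance is k / (n + 1); 0 is a dummy value when [p.2] is
   outside [A]. *)
have step (p : nat * V) : exists v, A p.2 ->
    S p.2 v /\ forall z, S p.2 z -> f z <= f v + k * p.1.+1%:R^-1.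
  have [Au|nAu] := pselect (A p.2); last by exists 0.
  have e0 : 0 < k * p.1.+1%:R^-1 by rewrite mulr_gt0// invr_gt0.
  have supS : has_sup [set f z | z in S p.2].
    split; first by exists (f p.2); exists p.2 => //; exact: S_refl.
    by exists M => _ [z [Az _] <-]; exact: fM.
  have [_ [v Sv <-] vsup] := sup_adherent e0 supS.
  exists v => _; split=> // z Sz.
  have fz : f z <= sup [set f z | z in S p.2] by apply: ub_le_sup; [case: supS|exists z].
  by apply: le_trans fz _; rewrite -lerBlDr ltW.
have [g gP] := choice step.
pose fix u n := if n is m.+1 then g (m, u m) else x.
have Au n : A (u n).
  by elim: n => //= n /(gP (n, u n))[[]].
have uS n : S (u n) (u n.+1) by have [] := gP (n, u n) (Au n).
have u_le n m : (n <= m)%N -> S (u n) (u m).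
  elim: m => [|m ih]; first by rewrite leqn0 => /eqP->; exact: S_refl.
  rewrite leq_eqVlt => /predU1P[->|]; first exact: S_refl.
  by rewrite ltnS => /ih nm; exact: S_trans nm (uS m).
have u_near n z : S (u n.+1) z -> `|u n.+1 - z| <= n.+1%:R^-1.
  move=> Sz; have [_ /(_ z (S_trans _ _ _ (uS n) Sz)) fz] := gP (n, u n) (Au n).
  have {}fz : f z <= f (u n.+1) + k * n.+1%:R^-1 by [].
  by case: Sz => _ fz'; rewrite -(ler_pM2l k0) -(lerD2l (f (u n.+1))) (le_trans fz').
have ucvg : cvg (u @ \oo).
  suff : cauchy (u @ \oo) by exact: cauchy_cvg.
  suff : cauchy_ex (u @ \oo) by exact: cauchy_exP.
  move=> e e0; rewrite /fmapE -ball_normE /ball_.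
  exists (u (Num.truncn e^-1).+1), (Num.truncn e^-1).+1 => // m nm /=.
  apply: (le_lt_trans (u_near _ _ (u_le _ _ nm))).
  by rewrite -[ltRHS]invrK ltf_pV2 ?posrE ?invr_gt0// truncnS_gt.
pose y := lim (u @ \oo); have uy : u @ \oo --> y by [].
have Sy n : S (u n) y.
  have Scl : closed (S (u n)).
    rewrite (_ : S (u n) = A `&` [set z | f (u n) + k * `|u n - z| - f z <= 0]).
      apply: closedI => //.
      apply: (@closed_comp _ _ (fun z => f (u n) + k * `|u n - z| - f z) [set r | r <= 0]).
        move=> z _; apply: cvgB; last exact: fcont.
        apply: cvgD; first exact: cvg_cst.
        apply: cvgM; first exact: cvg_cst.
        apply: cvg_norm; apply: cvgB; [exact: cvg_cst|exact: cvg_id].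
      exact: closed_le.
    by apply/seteqP; split=> z [Az /= fz]; split=> //=; lra.
  apply: (@closed_cvg _ _ \oo eventually_filter u) => //.
  by exists n => // m /= nm; exact: u_le.
exists y; split.
- by case: (Sy 0%N).
- by case: (Sy 0%N).
(* A violating z dominates y, hence every [u n], and so equals y. *)
move=> z Az; rewrite leNgt; apply/negP => yz.
have Syz : S y z by split=> //; rewrite distrC ltW.
have zy0 : z = y.
  have uz n : `|u n.+1 - z| <= n.+1%:R^-1 by apply: u_near; exact: S_trans (Sy _) Syz.
  apply/eqP/contraT; rewrite -subr_eq0 -normr_gt0 => e0.
  have e20 : 0 < `|z - y| / 2 by lra.
  have [n ne] : exists n, n.+1%:R^-1 < `|z - y| / 2.
    exists (Num.truncn (`|z - y| / 2)^-1).
    by rewrite -[ltRHS]invrK ltf_pV2 ?posrE ?invr_gt0// truncnS_gt.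
  have := uz n; have := u_near _ _ (Sy n.+1); have := ler_distD (u n.+1) z y.
  rewrite (distrC z (u _)); move: ne; move: (u n.+1) (n.+1%:R^-1) => w e; lra.
by move: yz; rewrite zy0 subrr normr0; lra.
Qed.

(** * Hahn-Banach by minimal sublinear functionals *)

Definition sublinear (R : realType) (V : lmodType R) (p : V -> R) :=
  (forall u v, p (u + v) <= p u + p v) /\
  (forall t u, 0 < t -> p (t *: u) <= t * p u).

Section Sublinear.
Variables (R : realType) (V : lmodType R).
Implicit Types (p q : V -> R) (C : set V).

Lemma sublinearZ p t u : sublinear p -> 0 < t -> p (t *: u) = t * p u.
Proof.
move=> [_ pZ] t0; apply/eqP; rewrite eq_le pZ//= -ler_pdivlMl//.
by rewrite -[in leLHS](scalerK (lt0r_neq0 t0) u) pZ// invr_gt0.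
Qed.

Lemma sublinear0 p : sublinear p -> p 0 = 0.
Proof. by move=> pS; have := @sublinearZ p 2 0 pS (ltr0Sn R 1); rewrite scaler0; lra. Qed.

Lemma sublinearN p u : sublinear p -> - p (- u) <= p u.
Proof.
by move=> pS; have [pD _] := pS; have := pD u (- u); rewrite subrr sublinear0//; lra.
Qed.

(** Take q v = inf over w in C of p (v + w) - f w. A linear h <= q then satisfies h <= p everywhere
    and h >= f on C: the sandwich form of Hahn-Banach. *)
Lemma sublinear_inf_cone p C (f : V -> R) :
    sublinear p -> C 0 -> (forall u v, C u -> C v -> C (u + v)) ->
    (forall t u, 0 < t -> C u -> C (t *: u)) ->
    f 0 = 0 -> (forall u v, C u -> C v -> f (u + v) = f u + f v) ->
    (forall t u, 0 < t -> C u -> f (t *: u) = t * f u) ->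
    (forall w, C w -> f w <= p w) ->
  exists q, [/\ sublinear q, forall v, q v <= p v &
    forall w, C w -> q (- w) <= - f w].
Proof.
move=> pS C0 CD CZ f0 fD fZ fp; have [pD pZ] := pS.
pose E v := [set p (v + w) - f w | w in C].
have E_inf v : has_inf (E v).
  split; first by exists (p (v + 0) - f 0); exists 0.
  (* Because f w <= p w <= p (v + w) + p (- v). *)
  exists (- p (- v)) => _ [w Cw <-].
  have := pD (v + w) (- v); rewrite addrC addKr => ?; have := fp _ Cw; lra.
pose q v := inf (E v).
have q_le v w : C w -> q v <= p (v + w) - f w.
  by move=> Cw; apply: ge_inf; [case: (E_inf v)|exists w].
exists q; split.
- split=> [u v|t u t0].
    rewrite leNgt; apply/negP => uv.
    have e0 : 0 < (q (u + v) - q u - q v) / 2 by lra.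
    have [_ [w Cw <-]] := inf_adherent e0 (E_inf u).
    have [_ [z Cz <-]] := inf_adherent e0 (E_inf v).
    have := q_le (u + v) _ (CD _ _ Cw Cz).
    have := pD (u + w) (v + z); rewrite addrACA fD// -/(q u) -/(q v); lra.
  rewrite -ler_pdivrMl//; apply: lb_le_inf; first by case: (E_inf u).
  move=> _ [w Cw <-]; rewrite ler_pdivrMl//.
  by have := q_le (t *: u) _ (CZ _ _ t0 Cw); rewrite -scalerDr fZ// (sublinearZ _ pS t0); lra.
- by move=> v; have := q_le v _ C0; rewrite addr0 f0 subr0.
- by move=> w Cw; have := q_le (- w) _ Cw; rewrite addNr sublinear0// sub0r.
Qed.

(** Zorn's lemma for the reversed pointwise order. A nonempty chain is bounded by its pointwise
    infimum, finite because every member is at least - p (- v) at v. *)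
Lemma minimal_sublinear p : sublinear p ->
  exists q, [/\ sublinear q, forall v, q v <= p v &
    forall q', sublinear q' -> (forall v, q' v <= q v) -> q' = q].
Proof.
move=> pS.
pose T := {q : V -> R | `[< sublinear q /\ forall v, q v <= p v >]}.
have TP (q : T) : sublinear (val q) /\ forall v, val q v <= p v.
  exact/asboolP/(valP q).
pose le (q q' : T) := `[< forall v, val q' v <= val q v >].
have pT : `[< sublinear p /\ forall v, p v <= p v >] by exact/asboolP.
have [|||A Atot|q qmax] := @Zorn T le.
- by move=> q; apply/asboolP.
- move=> q1 q2 q3 /asboolP h1 /asboolP h2; apply/asboolP => v.
  exact: le_trans (h2 v) (h1 v).
- move=> q1 q2 /asboolP h1 /asboolP h2; apply/val_inj/funext => v.
  by apply/eqP; rewrite eq_le h1 h2.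
- have [[q0 Aq0]|A0] := pselect (exists q : T, A q); last first.
    by exists (Sub p pT) => q Aq; exfalso; apply: A0; exists q.
  pose E v := [set val q v | q in A].
  have E_inf v : has_inf (E v).
    split; first by exists (val q0 v); exists q0.
    exists (- p (- v)) => _ [q Aq <-]; have [qS qp] := TP q.
    by have := sublinearN v qS; have := qp (- v); lra.
  pose r v := inf (E v).
  have r_le v (q : T) : A q -> r v <= val q v.
    by move=> Aq; apply: ge_inf; [case: (E_inf v)|exists q].
  have rT : `[< sublinear r /\ forall v, r v <= p v >].
    apply/asboolP; split; last first.
      by move=> v; apply: le_trans (r_le _ _ Aq0) _; have [] := TP q0.
    split=> [u v|t u t0].
      rewrite leNgt; apply/negP => uv.
      have e0 : 0 < (r (u + v) - r u - r v) / 2 by lra.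
      have [_ [q1 A1 <-]] := inf_adherent e0 (E_inf u).
      have [_ [q2 A2 <-]] := inf_adherent e0 (E_inf v).
      rewrite -/(r u) -/(r v) => h2 h1.
      have [[q1D _] _] := TP q1; have [[q2D _] _] := TP q2.
      (* The smaller of the two comparable near-minimisers serves at both u and v. *)
      case: (Atot _ _ A1 A2) => /asboolP q12.
        have := r_le (u + v) _ A2; have := q2D u v; have := q12 u; lra.
      have := r_le (u + v) _ A1; have := q1D u v; have := q12 v; lra.
    rewrite -ler_pdivrMl//; apply: lb_le_inf; first by case: (E_inf u).
    move=> _ [q Aq <-]; rewrite ler_pdivrMl//.
    by apply: le_trans (r_le _ _ Aq) _; have [[_ ->]] := TP q.
  by exists (Sub r rT) => q Aq; apply/asboolP => v; rewrite SubK; exact: r_le.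
- have [qS qp] := TP q; exists (val q); split=> // q' q'S q'q.
  have q'T : `[< sublinear q' /\ forall v, q' v <= p v >].
    by apply/asboolP; split=> // v; exact: le_trans (q'q v) (qp v).
  have := qmax (Sub q' q'T); rewrite /le SubK => /(_ (asboolT q'q)) <-.
  by rewrite SubK.
Qed.

(* By minimality, sublinear_inf_cone on the ray of v with f = p = q returns q,
   so q (- v) <= - q v. *)
Lemma minimal_sublinear_linear q : sublinear q ->
    (forall q', sublinear q' -> (forall v, q' v <= q v) -> q' = q) ->
  forall a u v, q (a *: u + v) = a * q u + q v.
Proof.
move=> qS qmin; have [qD _] := qS.
have qZ t v : 0 <= t -> q (t *: v) = t * q v.
  rewrite le_eqVlt => /predU1P[<-|/(sublinearZ _ qS)->//].
  by rewrite scale0r mul0r sublinear0.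
have qN v : q (- v) = - q v.
  apply/eqP; rewrite eq_le; apply/andP; split; last first.
    by have := sublinearN v qS; lra.
  pose C := [set t *: v | t in [set t : R | 0 <= t]].
  have [|||||||q' [q'S q'q q'N]] := @sublinear_inf_cone q C q qS.
  - by exists 0; rewrite /= ?scale0r.
  - by move=> _ _ [a a0 <-] [b b0 <-]; exists (a + b); rewrite ?scalerDl//= addr_ge0.
  - by move=> t _ t0 [a a0 <-]; exists (t * a); rewrite ?scalerA//= mulr_ge0// ltW.
  - exact: sublinear0.
  - move=> _ _ [a a0 <-] [b b0 <-].
    by rewrite -scalerDl !qZ ?mulrDl//; exact: addr_ge0.
  - by move=> t w t0 _; exact: sublinearZ.
  - by [].
  - rewrite -(qmin _ q'S q'q); move: q'N; rewrite (qmin _ q'S q'q); apply.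
    by exists 1; rewrite /= ?scale1r.
have qD' u v : q (u + v) = q u + q v.
  apply/eqP; rewrite eq_le qD/=.
  by have := qD (- u) (- v); rewrite -opprD !qN; lra.
move=> a u v; rewrite qD'; apply: (congr1 (+%R^~ _)).
have [a0|a0|->] := ltgtP a 0; last by rewrite scale0r mul0r sublinear0.
  by rewrite -[in LHS](opprK a) scaleNr qN qZ ?oppr_ge0 1?ltW// mulNr opprK.
exact: qZ (ltW a0).
Qed.

End Sublinear.

(** * The Bishop-Phelps theorem *)

Section Dual.
Variables (R : realType) (X : normedModType R).
Implicit Types (f g : topdual X) (x y : X).

Lemma topdual_norm_ub f x : `|f x| <= `|f| * `|x|.
Proof. exact: dual_norm_ub. Qed.

Lemma topdual_le f x : f x <= `|f| * `|x|.
Proof. exact: le_trans (ler_norm _) (topdual_norm_ub f x). Qed.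

Lemma topdual_norm_le f M : (forall x, `|x| <= 1 -> `|f x| <= M) -> `|f| <= M.
Proof. exact: dual_norm_le. Qed.

Lemma topdual_adherent f e : 0 < e -> exists2 x, `|x| <= 1 & `|f| - e < f x.
Proof.
move=> e0; apply: contrapT => fx.
suff : `|f| <= `|f| - e by lra.
have fle x : `|x| <= 1 -> f x <= `|f| - e.
  by move=> x1; rewrite leNgt; apply/negP => fe; apply: fx; exists x.
apply: topdual_norm_le => x x1; rewrite ler_norml fle// andbT.
by have := fle (- x); rewrite normrN linearN => /(_ x1); lra.
Qed.

Lemma bounded_linear_topdual (h : X -> R) k :
    (forall a u v, h (a *: u + v) = a * h u + h v) ->
    (forall v, `|h v| <= k * `|v|) ->
  exists g, forall v, g v = h v.
Proof.
move=> hlin hk.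
pose hl : {linear X -> R^o} := HB.pack (h : X -> R^o) (GRing.isLinear.Build R X R^o *:%R h hlin).
have hD : (h : X -> R^o) \in @dual_pred R X.
  apply/asboolP; split; first exact: hlin.
  apply: (@linear_bounded_continuous _ _ _ hl).1; apply/bounded_funP => r.
  have [r0|r0] := leP 0 r; last first.
    by exists 0 => x xr; have := normr_ge0 x; lra.
  exists (`|k| * r) => x xr; apply: le_trans (hk x) _.
  apply: le_trans (_ : _ <= `|k| * `|x|) _; first by rewrite ler_wpM2r ?ler_norm.
  by rewrite ler_wpM2l.
by exists (TopDual hD).
Qed.

End Dual.

Section BishopPhelps.
Variables (R : realType) (X : completeNormedModType R).
Implicit Types (f g : topdual X) (x y : X).

(** Ekeland's y satisfies f z - f y <= k |z - y| on the ball. Choose a linear h with h >= f on the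
    cone of feasible directions at y and h <= k |.| everywhere; then g = f - h is maximal at y and
    |f - g| <= k. *)
Lemma perturbation_attaining f x k : 0 < k -> `|x| <= 1 ->
  exists y g, [/\ `|y| <= 1, f x + k * `|x - y| <= f y, `|f - g| <= k &
    forall z, `|z| <= 1 -> g z <= g y].
Proof.
move=> k0 x1.
have [|||y [y1 xy ymax]] :=
  @ekeland_maximum R X [set z | `|z| <= 1] f `|f| k x _ _ _ k0 x1.
- apply: (@closed_comp _ _ (fun z : X => `|z|) [set r | r <= 1]).
    by move=> z _; exact: norm_continuous.
  exact: closed_le.
- exact: dual_continuous.
- by move=> z z1; apply: le_trans (topdual_le f z) _; rewrite ler_piMr.
pose C := [set w | exists2 l, 0 < l & `|y + l *: w| <= 1].
have pS : sublinear (fun v : X => k * `|v|).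
  split=> [u v|t u t0]; first by rewrite -mulrDr ler_wpM2l ?ler_normD// ltW.
  by rewrite normrZ gtr0_norm// mulrCA.
have [|||||||q [qS qk qC]] := @sublinear_inf_cone R X _ C f pS.
- by exists 1; rewrite // scaler0 addr0.
- move=> u v [a a0 ua] [b b0 vb]; have ab0 : 0 < a + b by exact: addr_gt0.
  (* This length makes the new point a convex combination of y + a u and y + b v. *)
  exists (a * b / (a + b)); first by rewrite divr_gt0// mulr_gt0.
  have -> : y + (a * b / (a + b)) *: (u + v) =
      (b / (a + b)) *: (y + a *: u) + (a / (a + b)) *: (y + b *: v).
    rewrite !scalerDr !scalerA addrACA -scalerDl -mulrDl (addrC b).
    rewrite divff ?lt0r_neq0// scale1r.
    by rewrite (mulrAC b _ a) (mulrAC a _ b) (mulrC b a).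
  have ca : 0 <= a / (a + b) by rewrite divr_ge0// ltW.
  have cb : 0 <= b / (a + b) by rewrite divr_ge0// ltW.
  have cab : b / (a + b) + a / (a + b) = 1.
    by rewrite -mulrDl addrC divff// lt0r_neq0.
  apply: le_trans (ler_normD _ _) _; rewrite -cab.
  by rewrite (normrZ _ (_ + a *: _)) (normrZ _ (_ + b *: _)) !ger0_norm// lerD ?ler_piMr.
- move=> t u t0 [a a0 ua]; exists (a / t); first exact: divr_gt0.
  by rewrite scalerA divfK ?lt0r_neq0.
- exact: linear0.
- by move=> u v _ _; exact: linearD.
- by move=> t u _ _; exact: linearZ.
- move=> w [l l0 wl]; have := ymax _ wl.
  rewrite linearD linearZ addrAC subrr add0r normrZ gtr0_norm//=.
  by rewrite mulrCA lerD2l ler_pM2l.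
have [h [hS hq hmin]] := minimal_sublinear qS.
have hlin := minimal_sublinear_linear hS hmin.
have hN v : h (- v) = - h v.
  by rewrite -scaleN1r -[_ *: _]addr0 hlin sublinear0// mulN1r addr0.
have hk v : h v <= k * `|v| by exact: le_trans (hq v) (qk v).
have habs v : `|h v| <= k * `|v|.
  by rewrite ler_norml hk andbT; have := hk (- v); rewrite hN normrN; lra.
have [h' h'E] := bounded_linear_topdual hlin habs.
exists y, (f - h'); split=> //.
- rewrite opprB addrC subrK; apply: topdual_norm_le => v v1.
  by rewrite h'E; apply: le_trans (habs v) _; rewrite ler_piMr// ltW.
- move=> z z1; have : C (z - y).
    by exists 1; rewrite // scale1r addrC subrK.
  move=> /qC; have := hq (- (z - y)); rewrite hN -!h'E.
  rewrite -[(f - h') z]/(f z - h' z) -[(f - h') y]/(f y - h' y).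
  by rewrite !linearB/=; lra.
Qed.

(** Since k < 1 = |f|, g is nonzero; maximality at y gives g y = |g| and |y| = 1, and f y <= 1 turns
    the gain k |x - y| into the distance bound. *)
Lemma bishop_phelps f x k : `|x| = 1 -> `|f| = 1 -> 0 < k < 1 ->
  exists y g, [/\ norming_pairs X (y, `|g|^-1 *: g), 0 < `|g|,
    `|x - y| <= (1 - f x) / k & `|f - g| <= k].
Proof.
move=> x1 f1 /andP[k0 k1].
have [|y [g [y1 xy fg gy]]] := @perturbation_attaining f x k k0; first by rewrite x1.
have g0 : 0 < `|g| by have := lerB_dist f g; rewrite f1; lra.
have gE : g y = `|g|.
  apply/eqP; rewrite eq_le; apply/andP; split.
    by apply: le_trans (topdual_le g y) _; rewrite ler_piMr.
  apply: topdual_norm_le => z z1; rewrite ler_norml gy// andbT.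
  by have := gy (- z); rewrite normrN linearN => /(_ z1); lra.
have {}y1 : `|y| = 1.
  apply/eqP; rewrite eq_le y1/= -(ler_pM2l g0) mulr1 -{1}gE.
  exact: topdual_le.
exists y, g; split=> //.
- split=> //=; first by rewrite normrZ normfV normr_id mulVf// lt0r_neq0.
  by rewrite -[LHS]/(`|g|^-1 * g y) gE mulVf// lt0r_neq0.
- rewrite ler_pdivlMr// mulrC.
  have : f y <= 1.
    by apply: le_trans (topdual_le f y) _; rewrite f1 y1 mulr1.
  lra.
Qed.

End BishopPhelps.

(** * Pairs far from all norming pairs *)

Section Normalization.
Variables (R : realType) (V : normedModType R).
Implicit Type v : V.

Lemma norm_normalized v : 0 < `|v| -> `| `|v|^-1 *: v| = 1.
Proof. by move=> v0; rewrite normrZ normfV normr_id mulVf// lt0r_neq0. Qed.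

Lemma dist_normalized v : 0 < `|v| -> `|v - `|v|^-1 *: v| = `|1 - `|v| |.
Proof.
move=> v0; rewrite -{1}[v]scale1r -scalerBl normrZ.
rewrite -[X in _ * X]normr_id -normrM mulrBl mul1r mulVf ?lt0r_neq0//.
by rewrite distrC.
Qed.

End Normalization.

Section Far.
Variables (R : realType) (X : completeNormedModType R).
Implicit Types (f g : topdual X) (x y : X).

(** The failure of the condition defining the moduli, phrased so that a norming pair with y near x
    yields a lower bound on |f - g|. *)
Definition far e x f :=
  forall y g, norming_pairs X (y, g) -> `|x - y| < e -> e <= `|f - g|.

Lemma not_far e x f : ~ far e x f ->
  exists y g, [/\ norming_pairs X (y, g), `|x - y| < e & `|f - g| < e].
Proof.
move=> nf; apply: contrapT => ny; apply: nf => y g yg xy.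
by rewrite leNgt; apply/negP => fg; apply: ny; exists y, g.
Qed.

Lemma normalized_dist f g k : `|f - g| <= k -> 0 < `|g| ->
  `|f - `|g|^-1 *: g| <= k + `|1 - `|g| |.
Proof.
move=> fg g0; rewrite -(dist_normalized g0).
by apply: le_trans (ler_distD g _ _) _; rewrite lerD2r.
Qed.

Lemma normalized_near (f g : topdual X) k : `|f| = 1 -> `|f - g| <= k ->
  `|1 - `|g| | <= k.
Proof. by move=> <- fg; apply: le_trans (ler_dist_dist _ _) fg. Qed.

(** Here a, b are the norms of a pair and v its value after normalisation. With t = 1 - a + (1 - b),
    the bounds t <= 2 and t^2 >= 4 (1 - a)(1 - b) give a b (1 + t) <= 1, so v >= v a b (1 + t) > (1
    - eps^2/2)(1 + t). *)
Lemma ball_far_arith (eps a b v : R) : 0 < eps < 1 -> 0 < a <= 1 -> 0 < b <= 1 ->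
    v <= 1 -> 1 - eps ^+ 2 / 2 < v * (a * b) ->
  1 - v < eps ^+ 2 / 2 - (1 - eps ^+ 2 / 2) * (1 - a + (1 - b)).
Proof.
move=> /andP[e0 e1] /andP[a0 a1] /andP[b0 b1] v1.
have : eps ^+ 2 < 1 by rewrite expr_lt1// ltW.
have : 0 < eps ^+ 2 by rewrite exprn_gt0.
move: (eps ^+ 2) => E E0 E1 vab.
have ab0 : 0 < a * b by rewrite mulr_gt0.
have v0 : 0 < v by rewrite -(pmulr_lgt0 _ ab0); lra.
pose t := 1 - a + (1 - b).
have t0 : 0 <= t by rewrite /t; lra.
have abt : a * b * (1 + t) <= 1.
  have -> : a * b * (1 + t) = 1 - (t ^+ 2 - (1 - a) * (1 - b) * (1 + t)).
    by rewrite /t; ring.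
  have h1 : (1 - a) * (1 - b) * (1 + t) <= (1 - a) * (1 - b) * 3.
    by rewrite ler_wpM2l ?mulr_ge0// /t; lra.
  have h2 : (1 - a) * (1 - b) * 3 <= t ^+ 2.
    have -> : t ^+ 2 = (1 - a) * (1 - b) * 4 + (a - b) ^+ 2 by rewrite /t; ring.
    have : 0 <= (1 - a) * (1 - b) by rewrite mulr_ge0//; lra.
    by have := sqr_ge0 (a - b); lra.
  lra.
have : (1 - E / 2) * (1 + t) < v * (a * b) * (1 + t) by rewrite ltr_pM2r//; lra.
have : v * (a * b * (1 + t)) <= v by rewrite ler_piMr// ltW.
rewrite -/t; lra.
Qed.

(* With r = 1 - |x| and s = 1 - |f|, apply Bishop-Phelps to the normalised pair with
   k ~ A / (e - r), where 1 - f(x)/(|f||x|) < A := eps^2/2 - (1 - eps^2/2)(r + s);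
   if the pair is far, then e - s <= 2 k, i.e. (e - s)(e - r) < 2 A. *)
Lemma ball_far eps e x f : 0 < eps < 1 -> 3 / 4 * eps <= e <= eps ->
    `|x| <= 1 -> `|f| <= 1 -> 1 - eps ^+ 2 / 2 < f x -> far e x f ->
  (2 - eps - eps ^+ 2) * (1 - `|x| + (1 - `|f|)) < eps ^+ 2 - e ^+ 2.
Proof.
move=> eps01 /andP[e34 eeps] x1 f1 fx xf; have /andP[eps0 eps1] := eps01.
have E1 : eps ^+ 2 < 1 by rewrite expr_lt1// ltW.
have E2 : eps ^+ 2 < eps by rewrite expr2 -{3}[eps]mulr1 ltr_pM2l.
have fx_x : f x <= `|x| by apply: le_trans (topdual_le f x) _; rewrite ler_piMl.
have fx_f : f x <= `|f| by apply: le_trans (topdual_le f x) _; rewrite ler_piMr.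
have fx0 : 0 < f x by lra.
have x0 : 0 < `|x| by lra.
have f0 : 0 < `|f| by lra.
pose x' := `|x|^-1 *: x; pose f' := `|f|^-1 *: f.
have x'1 : `|x'| = 1 := norm_normalized x0.
have f'1 : `|f'| = 1 := norm_normalized f0.
have f'x' : f' x' * (`|x| * `|f|) = f x.
  rewrite -[f' x']/(`|f|^-1 * f x') linearZ/= -[_ *: _]/(`|x|^-1 * f x).
  by field; rewrite !lt0r_neq0.
have f'x'1 : f' x' <= 1.
  by apply: le_trans (topdual_le _ _) _; rewrite f'1 x'1 mulr1.
have := @ball_far_arith eps `|x| `|f| (f' x') eps01; rewrite f'x' x0 f0.
move=> /(_ x1 f1 f'x'1 fx).
set A := (A in 1 - f' x' < A) => vA.
(* A midpoint leaves room on both sides: 1 - f' x' < A' gives |x - y| < e, and A' < A gives the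
   strict conclusion. *)
pose A' := (1 - f' x' + A) / 2.
pose r := 1 - `|x|; pose s := 1 - `|f|.
have r0 : 0 <= r by rewrite /r; lra.
have s0 : 0 <= s by rewrite /s; lra.
have AE : A = eps ^+ 2 / 2 - (1 - eps ^+ 2 / 2) * (r + s) by [].
(* This ensures k < 1. Since r <= 1/2, A <= 3/4 eps^2 - r < 3/4 eps - r, whence the lower bound
   assumed on e. *)
have Ar : A < e - r.
  have : 0 <= (1 - eps ^+ 2 / 2) * s by rewrite mulr_ge0//; lra.
  have : eps ^+ 2 / 2 * r <= eps ^+ 2 / 2 * (1 / 2).
    by rewrite ler_wpM2l ?divr_ge0 ?exprn_ge0 ?ltW// /r; lra.
  rewrite AE; lra.
have er0 : 0 < e - r by rewrite (le_lt_trans _ Ar)//; lra.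
have A'0 : 0 < A' by rewrite /A'; lra.
have [|y [g [yg g0 xy fg]]] := @bishop_phelps R X f' x' (A' / (e - r)) x'1 f'1.
  rewrite divr_gt0//= ltr_pdivrMr// mul1r /A'; lra.
have fdist : `|f - f'| = s by rewrite dist_normalized// ger0_norm.
have xdist : `|x - x'| = r by rewrite dist_normalized// ger0_norm.
have xye : `|x - y| < e.
  apply: le_lt_trans (ler_distD x' _ _) _; rewrite xdist -ltrBrDl.
  apply: le_lt_trans xy _; rewrite invf_div mulrA ltr_pdivrMr//.
  by rewrite mulrC ltr_pM2l// /A'; lra.
have := xf _ _ yg xye.
have := ler_distD f' f (`|g|^-1 *: g).
have := normalized_dist fg g0; have := normalized_near f'1 fg.
rewrite fdist => h1 h2 h3 h4.
have : e - s <= 2 * (A' / (e - r)) by lra.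
rewrite mulrA ler_pdivlMr//.
have rs0 : 0 <= r * s by rewrite mulr_ge0.
have : e * (r + s) <= eps * (r + s) by rewrite ler_wpM2r// addr_ge0.
by rewrite -/r -/s /A' AE !expr2 in vA *; lra.
Qed.

(** For a far pair, [ball_far] at e = eps would make a nonnegative quantity negative. *)
Lemma exists_near_norming_pair eps : 0 < eps < 1 -> forall x f, `|x| <= 1 -> `|f| <= 1 ->
    1 - eps ^+ 2 / 2 < f x ->
  exists y g, [/\ norming_pairs X (y, g), `|x - y| < eps & `|f - g| < eps].
Proof.
move=> eps01 x f x1 f1 fx; have /andP[eps0 eps1] := eps01.
apply: not_far => /(ball_far eps01); rewrite subrr lexx andbT => /(_ _ x1 f1 fx) h.
have : 0 <= (2 - eps - eps ^+ 2) * (1 - `|x| + (1 - `|f|)).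
  have : eps ^+ 2 < 1 by rewrite expr_lt1// ltW.
  by move=> ?; rewrite mulr_ge0//; lra.
by rewrite leNgt h//; lra.
Qed.

Lemma far_anti e e' x f : e <= e' -> far e' x f -> far e x f.
Proof.
by move=> ee' xf y g yg xy; apply: le_trans ee' (xf _ _ yg (lt_le_trans xy ee')).
Qed.

(** By [ball_far], pairs far at level eps - tau have norms close to 1; normalising them raises f x
    and costs little farness. *)
Lemma sphere_far eps : 0 < eps < 1 ->
    (forall e, 0 < e < eps -> exists x f,
       [/\ `|x| <= 1, `|f| <= 1, 1 - eps ^+ 2 / 2 < f x & far e x f]) ->
  forall e, e < eps -> exists x f,
    [/\ `|x| = 1, `|f| = 1, 1 - eps ^+ 2 / 2 < f x & far e x f].
Proof.
move=> eps01 fars e0 e0eps; have /andP[eps0 eps1] := eps01.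
pose e := Num.max e0 (3 / 4 * eps).
have e0e : e0 <= e by rewrite le_max lexx.
have e34 : 3 / 4 * eps <= e by rewrite le_max lexx orbT.
have eeps : e < eps by rewrite gt_max e0eps/=; lra.
have E1 : eps ^+ 2 < 1 by rewrite expr_lt1// ltW.
pose c := 2 - eps - eps ^+ 2; have c0 : 0 < c by rewrite /c; lra.
have c2 : c < 2 by rewrite /c; have : 0 <= eps ^+ 2 by [rewrite exprn_ge0// ltW]; lra.
(* Then eps^2 - (eps - tau)^2 <= 2 tau = c (eps - e) / 2, so the norm defects sum to less than (eps
   - e) / 2; tau is below (eps - e) / 2 too, and level e survives. *)
pose tau := c * (eps - e) / 4.
have tau0 : 0 < tau by rewrite divr_gt0// mulr_gt0// subr_gt0.
have taue : tau < (eps - e) / 2.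
  have : c * (eps - e) < 2 * (eps - e) by rewrite ltr_pM2r// subr_gt0.
  by rewrite /tau; lra.
have [|x [f [x1 f1 fx xf]]] := fars (eps - tau); first by apply/andP; split; lra.
have := ball_far eps01 _ x1 f1 fx xf.
have -> : 3 / 4 * eps <= eps - tau <= eps by apply/andP; split; lra.
move=> /(_ isT); rewrite -/c.
have -> : eps ^+ 2 - (eps - tau) ^+ 2 = tau * (2 * eps - tau) by ring.
have : tau * (2 * eps - tau) <= tau * 2 by rewrite ler_pM2l//; lra.
move=> h1 h2; have : c * (1 - `|x| + (1 - `|f|)) < c * ((eps - e) / 2).
  by apply: lt_le_trans h2 _; apply: le_trans h1 _; rewrite /tau; lra.
rewrite ltr_pM2l// => rs.
have fx_x : f x <= `|x| by apply: le_trans (topdual_le f x) _; rewrite ler_piMl.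
have fx_f : f x <= `|f| by apply: le_trans (topdual_le f x) _; rewrite ler_piMr.
have fx0 : 0 < f x by lra.
have x0 : 0 < `|x| by lra.
have f0 : 0 < `|f| by lra.
pose x' := `|x|^-1 *: x; pose f' := `|f|^-1 *: f.
have x'1 : `|x'| = 1 := norm_normalized x0.
have f'1 : `|f'| = 1 := norm_normalized f0.
have fdist : `|f - f'| = 1 - `|f|.
  by rewrite dist_normalized// ger0_norm// subr_ge0.
have xdist : `|x - x'| = 1 - `|x|.
  by rewrite dist_normalized// ger0_norm// subr_ge0.
exists x', f'; split=> //.
- apply: lt_le_trans fx _.
  rewrite -[f' x']/(`|f|^-1 * f x') linearZ/= -[_ *: _]/(`|x|^-1 * f x).
  by rewrite mulrA ler_peMl ?(ltW fx0)// mulr_ege1// invf_ge1.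
- apply: far_anti e0e _ => y g yg xy.
  have xy' : `|x - y| < eps - tau.
    by apply: le_lt_trans (ler_distD x' _ _) _; rewrite xdist; lra.
  have := xf _ _ yg xy'; have := ler_distD f' f g; rewrite fdist; lra.
Qed.

End Far.

(** * Almost isometric copies of the square *)

(** c and d are to be the images of the two coordinate vectors of the square. *)
Definition almost_square (R : realType) (V : normedModType R) :=
  forall t : R, 0 < t -> exists c d : V,
    [/\ `|c + d| <= 1, `|c - d| <= 1, 1 - t <= `|c| & 1 - t <= `|d|].

Section AlmostSquare.
Variables (R : realType).

(** If x almost norms c, the bounds on c + d and c - d force d x ~ 0; likewise c y ~ 0 when y almost
    norms d. So (c + d)(x + y) and (c - d)(x - y) are close to 2. *)
Lemma almost_square_predual (X : normedModType R) :
  almost_square (topdual X) -> almost_square X.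
Proof.
move=> sq t t0; have t40 : 0 < t / 4 by lra.
have [c [d [cd cd' c1 d1]]] := sq _ t40.
have [x x1 cx] := topdual_adherent c t40.
have [y y1 dy] := topdual_adherent d t40.
have ub (f : topdual X) z : `|f| <= 1 -> `|z| <= 1 -> f z <= 1.
  by move=> f1 z1; apply: le_trans (topdual_le f z) _; rewrite mulr_ile1.
have half (z : X) : 2^-1 *: z + 2^-1 *: z = z.
  by rewrite -scalerDl -[RHS]scale1r; congr (_ *: _); lra.
have half0 (f : topdual X) (z : X) (r : R) : `|f| <= 1 -> 2 * r <= f z ->
    r <= `|2^-1 *: z|.
  move=> f1 fz; rewrite normrZ ger0_norm ?invr_ge0//.
  have := topdual_le f z.
  have : `|f| * `|z| <= `|z| by rewrite ler_piMl.
  lra.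
exists (2^-1 *: (x + y)), (2^-1 *: (x - y)); split.
- by rewrite -scalerDr addrACA subrr addr0 scalerDr half.
- by rewrite -scalerBr opprB addrC addrA subrK scalerDr half.
- apply: (half0 (c + d)) => //.
  have -> : (c + d) (x + y) = c x + d x + (c y + d y) by rewrite linearD.
  have : c x - d x <= 1 := ub _ _ cd' x1.
  have : d y - c y <= 1 by apply: (ub (d - c)); rewrite // distrC.
  lra.
- apply: (half0 (c - d)) => //.
  have -> : (c - d) (x - y) = c x - d x - (c y - d y) by rewrite linearB.
  have : c x + d x <= 1 := ub _ _ cd x1.
  have : c y + d y <= 1 := ub _ _ cd y1.
  lra.
Qed.

Lemma rV2_norm (v : 'rV[R]_2) : `|v| = Num.max `|v 0 0| `|v 0 1|.
Proof.
rewrite -[LHS]/(mx_norm v) mx_normrE; apply/eqP; rewrite eq_le; apply/andP; split.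
  apply/bigmax_leP; split=> [|[i j] _ /=]; first by rewrite le_max normr_ge0.
  rewrite (ord1 i); case: j => -[|[|//]] j2.
    by rewrite (_ : Ordinal j2 = 0) ?le_max ?lexx//; exact: val_inj.
  by rewrite (_ : Ordinal j2 = 1) ?le_max ?lexx ?orbT//; exact: val_inj.
rewrite ge_max; apply/andP; split.
  exact: (le_bigmax _ (fun ij : 'I_1 * 'I_2 => `|v ij.1 ij.2|) (0, 0)).
exact: (le_bigmax _ (fun ij : 'I_1 * 'I_2 => `|v ij.1 ij.2|) (0, 1)).
Qed.

(** Expand in c + d and c - d: |s + t|/2 + |s - t|/2 is the maximum of |s| and |t|. *)
Lemma square_norm_le (V : normedModType R) (c d : V) (s t : R) :
  `|c + d| <= 1 -> `|c - d| <= 1 -> `|s *: c + t *: d| <= Num.max `|s| `|t|.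
Proof.
move=> cd cd'.
have -> : s *: c + t *: d = ((s + t) / 2) *: (c + d) + ((s - t) / 2) *: (c - d).
  rewrite !scalerDr scalerN addrACA -scalerDl -scalerBl.
  by congr (_ *: _ + _ *: _); lra.
apply: (le_trans (ler_normD _ _)); rewrite (normrZ _ (c + d)) (normrZ _ (c - d)).
have h1 : `|(s + t) / 2| * `|c + d| <= `|(s + t) / 2| by rewrite ler_piMr.
have h2 : `|(s - t) / 2| * `|c - d| <= `|(s - t) / 2| by rewrite ler_piMr.
apply: (le_trans (lerD h1 h2)); rewrite le_max.
have [|] := lerP `|s| `|t| => [/ler_normlP[]|/ltW/ler_normlP[]] st st'; apply/orP; [right|left].
all: move: (ler_norm s) (ler_norm (- s)) (ler_norm t) (ler_norm (- t)) st st'; rewrite !normrN.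
all: by case: (ger0P ((s + t) / 2)); case: (ger0P ((s - t) / 2)); lra.
Qed.

(** If |t| <= |s|, write 2 s c = (s c + t d) + (s c - t d), where the last term has norm at most
    |s|. *)
Lemma square_norm_ge (V : normedModType R) (c d : V) (e s t : R) :
    `|c + d| <= 1 -> `|c - d| <= 1 -> 1 - e <= `|c| -> 1 - e <= `|d| ->
  (1 - 2 * e) * Num.max `|s| `|t| <= `|s *: c + t *: d|.
Proof.
wlog st : c d s t / `|t| <= `|s|.
  move=> W cd cd' c1 d1; have [ts|/ltW ts] := leP `|t| `|s|.
    by have := W c d s t ts cd cd' c1 d1; rewrite max_l.
  have := W d c t s ts; rewrite addrC distrC => /(_ cd cd' d1 c1).
  by rewrite max_l// (addrC (t *: d)).
move=> cd cd' c1 _; rewrite max_l//.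
have : `|s *: c - t *: d| <= `|s|.
  rewrite -scaleNr; apply: le_trans (square_norm_le s (- t) cd cd') _.
  by rewrite normrN max_l.
have : `|(2 * s) *: c| <= `|s *: c + t *: d| + `|s *: c - t *: d|.
  apply: le_trans (ler_normD _ _).
  by rewrite addrACA subrr addr0 -scalerDl -mulr2n mulr_natl.
rewrite normrZ normrM ger0_norm//.
have : (1 - e) * `|s| <= `|c| * `|s| by rewrite ler_wpM2r.
lra.
Qed.

Lemma almost_square_copies (V : normedModType R) :
  almost_square V -> almost_isometric_copies V 'rV[R]_2.
Proof.
move=> sq e e0.
(* The first bound yields (1 - 2 e')(1 + e) > 1, the second 1 - 2 e' > 0. *)
pose e' := Num.min (e / 4 / (1 + e)) (1 / 4).
have e'0 : 0 < e' by rewrite lt_min !divr_gt0//; lra.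
have [c [d [cd cd' c1 d1]]] := sq _ e'0.
pose T (v : 'rV[R]_2) : V := v 0 0 *: c + v 0 1 *: d.
have Tlin : linear T.
  by move=> a u v; rewrite /T !mxE !scalerDl scalerDr !scalerA addrACA.
have T_le v : `|T v| <= `|v| by rewrite rV2_norm square_norm_le.
have T_ge v : (1 - 2 * e') * `|v| <= `|T v| by rewrite rV2_norm square_norm_ge.
have e'1 : 0 < 1 - 2 * e'.
  have : e' <= 1 / 4 by rewrite ge_min lexx orbT.
  lra.
pose Tl : {linear 'rV[R]_2 -> V} := HB.pack T (GRing.isLinear.Build R 'rV[R]_2 V *:%R T Tlin).
have Tinj : injective T.
  move=> u v uv; apply/eqP; rewrite -subr_eq0 -normr_le0 -(pmulr_rle0 _ e'1).
  apply: le_trans (T_ge _) _; have -> : T (u - v) = T u - T v := linearB Tl u v.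
  by rewrite uv subrr normr0.
pose S (w : V) : 'rV[R]_2 := xget 0 [set v | T v = w].
have TK : cancel T S.
  by move=> v; apply: Tinj; apply: (@xgetPex _ _ [set u | T u = T v]); exists v.
exists (range T), Tl, S; split=> //.
- split=> [|a u v].
    by rewrite inE; exists 0 => //; exact: (linear0 Tl).
  rewrite !inE => -[u' _ <-] [v' _ <-]; exists (a *: u' + v') => //.
  exact: Tlin.
- split=> [v _|u v _ _|w [v _ <-]]; [by exists v|exact: Tinj|by exists v].
- apply: (@le_lt_trans _ _ 1%:E); last by rewrite lte_fin ltrDl.
  by apply: ge_ereal_sup => _ [v [_ v1] <-]; rewrite lee_fin; exact: le_trans (T_le v) _.
- apply: (@le_lt_trans _ _ ((1 - 2 * e')^-1)%:E).
    apply: ge_ereal_sup => _ [_ [[v _ <-] v1] <-]; rewrite lee_fin TK.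
    rewrite -(ler_pM2l e'1) divff ?lt0r_neq0//.
    exact: le_trans (T_ge v) v1.
  rewrite lte_fin -(ltr_pM2l e'1) divff ?lt0r_neq0//.
  have : e' <= e / 4 / (1 + e) by rewrite ge_min lexx.
  rewrite ler_pdivlMr; lra.
Qed.

End AlmostSquare.

(** * Extremal pairs on the spheres *)

Section Extremal.
Variables (R : realType) (X : completeNormedModType R).
Implicit Types (f g : topdual X) (x y : X).

(* With e = eps (1 - tau), k = eps^2 / (2 e) ~ eps / 2, g from Bishop-Phelps and
   m = |g|: |f - g/m| >= e forces |1 - m| ~ k; m ~ 1 + k is impossible, and when
   m ~ 1 - k the vectors a = (f - g)/k and b = g/m satisfy |a + b| ~ |a - b| ~ 2,
   because f = k (a + b) + (m - k) b and f - b = k (a - b) + (m - 1 + k) b. *)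
Lemma sphere_far_almost_square eps : 0 < eps < 1 ->
    (forall e, e < eps -> exists x f,
       [/\ `|x| = 1, `|f| = 1, 1 - eps ^+ 2 / 2 < f x & far e x f]) ->
  almost_square (topdual X).
Proof.
move=> /andP[eps0 eps1] fars t t0.
(* The three bounds serve respectively to exclude m >= 1, to reach precision t, and to get k <
   1/2. *)
pose tau := Num.min (eps / 8) (Num.min (t / 4) ((1 - eps) / 2)).
have tau0 : 0 < tau by rewrite !lt_min; apply/and3P; split; lra.
have tau_eps : tau <= eps / 8 by rewrite ge_min lexx.
have tau_t : tau <= t / 4 by rewrite !ge_min lexx orbT.
have tau_1 : tau <= (1 - eps) / 2 by rewrite !ge_min lexx !orbT.
pose D := 1 - tau; have D0 : 0 < D by rewrite /D; lra.
have DD : 1 - 2 * tau <= D ^+ 2.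
  have -> : D ^+ 2 = 1 - 2 * tau + tau ^+ 2 by rewrite /D; ring.
  by rewrite lerDl sqr_ge0.
(* The choice k e = eps^2/2 > 1 - f x makes Bishop-Phelps give |x - y| < e. *)
pose e := eps * D; pose k := eps / (2 * D).
have kD : k * D = eps / 2 by rewrite /k; field; rewrite lt0r_neq0.
have ke : k * e = eps ^+ 2 / 2 by rewrite /e mulrCA kD; field.
have ek : e = k * (2 * D ^+ 2).
  have -> : k * (2 * D ^+ 2) = k * D * (2 * D) by ring.
  by rewrite kD /e; field.
have k0 : 0 < k by rewrite divr_gt0// mulr_gt0.
have k12 : k < 1 / 2.
  by rewrite -(ltr_pM2r D0) kD /D; lra.
have e_eps : e < eps by rewrite /e gtr_pMr// /D; lra.
have [x [f [x1 f1 fx xf]]] := fars e e_eps.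
have [|y [g [yg g0 xy fg]]] := @bishop_phelps R X f x k x1 f1.
  by rewrite k0/=; lra.
have xye : `|x - y| < e.
  by apply: le_lt_trans xy _; rewrite ltr_pdivrMr// mulrC ke; lra.
have {xf} e_le := xf _ _ yg xye.
pose m := `|g|; pose b := m^-1 *: g.
have b1 : `|b| = 1 := norm_normalized g0.
have gE : g = m *: b by rewrite scalerA divff ?scale1r// lt0r_neq0.
have mk : `|1 - m| <= k := normalized_near f1 fg.
have e_le' : e <= k + `|1 - m| := le_trans e_le (normalized_dist fg g0).
have e_k : e = 2 * k * D ^+ 2 by rewrite ek; ring.
(* If m >= 1, then m (f - b) = (m - 1) f + (f - g) gives m e <= m - 1 + k; with m <= 1 + k this
   yields e + k e <= 2 k, impossible as e ~ 2 k. *)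
have [m1|m1] := ltP m 1; last first.
  exfalso; move: mk; rewrite distrC ger0_norm ?subr_ge0// => mk.
  have : m * e <= m - 1 + k.
    apply: le_trans (_ : m * `|f - b| <= _); first by rewrite ler_pM2l.
    rewrite -{1}[m]gtr0_norm// -normrZ.
    have -> : m *: (f - b) = (m - 1) *: f + (f - g).
      by rewrite scalerBr -gE scalerBl scale1r addrA subrK.
    apply: le_trans (ler_normD _ _) _.
    by rewrite normrZ f1 mulr1 ger0_norm ?subr_ge0// lerD2l.
  have : (1 - e) * m <= (1 - e) * (1 + k) by rewrite ler_wpM2l; lra.
  have DDe : eps * (1 - 2 * tau) <= eps * D ^+ 2 by rewrite ler_pM2l.
  have : D * (e + k * e) <= D * (2 * k) -> False.
    have -> : D * (e + k * e) = eps * D ^+ 2 + eps * eps / 2 * D.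
      by rewrite ke /e; ring.
    have -> : D * (2 * k) = eps by rewrite mulrC -mulrA kD; field.
    have : eps * (eps / 4) < eps * (eps / 2 * D).
      have h : eps / 2 * (1 / 2) < eps / 2 * D by rewrite ltr_pM2l ?divr_gt0// /D; lra.
      by rewrite ltr_pM2l//; lra.
    have : eps * tau <= eps * (eps / 8) by rewrite ler_pM2l.
    lra.
  by rewrite ler_pM2l//; lra.
have m1E : `|1 - m| = 1 - m by rewrite ger0_norm// subr_ge0 ltW.
move: mk e_le'; rewrite m1E => mk e_le'.
pose a := k^-1 *: (f - g).
have kaE : k *: a = f - g by rewrite scalerA divff ?scale1r// lt0r_neq0.
have a1 : `|a| <= 1.
  by rewrite -(ler_pM2l k0) mulr1 -{1}[k]gtr0_norm// -normrZ kaE.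
have half (V : lmodType R) (z : V) : 2^-1 *: z + 2^-1 *: z = z.
  by rewrite -scalerDl -[RHS]scale1r; congr (_ *: _); lra.
have halfE (z : topdual X) : `|2^-1 *: z| = `|z| / 2.
  by rewrite normrZ ger0_norm ?invr_ge0// mulrC.
have kn (z : topdual X) : `|k *: z| = k * `|z| by rewrite normrZ gtr0_norm.
exists (2^-1 *: (a + b)), (2^-1 *: (a - b)); split.
- by rewrite -scalerDr addrACA subrr addr0 scalerDr half.
- by rewrite -scalerBr opprB addrC addrA subrK scalerDr half b1.
- have fE : f = k *: (a + b) + (m - k) *: b.
    by rewrite scalerDr kaE scalerBl -gE addrACA subrK subrr addr0.
  have : 1 <= k * `|a + b| + (m - k).
    rewrite -f1 {1}fE -kn -[X in _ <= _ + X]mulr1 -b1.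
    rewrite -[X in _ <= _ + X * _]ger0_norm; last by lra.
    by rewrite -normrZ ler_normD.
  (* As m <= 1 + k - e by [e_le'], k |a + b| >= 1 - m + k >= e = 2 k D^2. *)
  move=> h; rewrite halfE ler_pdivlMr// -(ler_pM2l k0).
  have : k * (1 - 2 * tau) <= k * D ^+ 2 by rewrite ler_pM2l.
  have : k * (1 - t) <= k * (1 - 2 * tau) by rewrite ler_pM2l//; lra.
  lra.
- have fE : f - b = k *: (a - b) + (k - 1 + m) *: b.
    by rewrite scalerBr kaE scalerDl scalerBl scale1r -gE (addrC _ g) addrACA subrK addKr.
  have : e <= k * `|a - b| + (k - 1 + m).
    apply: le_trans e_le _; rewrite {1}fE -kn -[X in _ <= _ + X]mulr1 -b1.
    rewrite -[X in _ <= _ + X * _]ger0_norm; last by lra.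
    by rewrite -normrZ ler_normD.
  (* Now k |a - b| >= e - (k - 1 + m) >= 2 e - 2 k = 2 k (2 D^2 - 1). *)
  move=> h; rewrite halfE ler_pdivlMr// -(ler_pM2l k0).
  have : k * (1 - 2 * tau) <= k * D ^+ 2 by rewrite ler_pM2l.
  have : k * (1 - t) <= k * (1 - 4 * tau) by rewrite ler_pM2l//; lra.
  lra.
Qed.

End Extremal.

(** * The moduli *)

Section Moduli.
Variables (R : realType) (X : completeNormedModType R).
Implicit Types (f g : topdual X) (x y : X).

Lemma sqrt2_bounds (delta : R) : 0 < delta < 2^-1 ->
  0 < Num.sqrt (2 * delta) < 1 /\ delta = Num.sqrt (2 * delta) ^+ 2 / 2.
Proof.
move=> /andP[d0 d1]; split; last first.
  by rewrite sqr_sqrtr ?mulr_ge0 ?ltW// mulrAC divff// mul1r.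
by rewrite sqrtr_gt0 mulr_gt0//= -[ltRHS]sqrtr1 ltr_sqrt//; lra.
Qed.

Lemma BPB_modulus_on_le (D : set (X * topdual X)) (delta e : R) : 0 < e ->
    (forall x f, D (x, f) -> 1 - delta < f x ->
      exists y g, [/\ norming_pairs X (y, g), `|x - y| < e & `|f - g| < e]) ->
  BPB_modulus_on D delta <= e.
Proof.
by move=> e0 De; apply: ge_inf; [exists 0 => r [/ltW]|split].
Qed.

Lemma lt_BPB_modulus_on (D : set (X * topdual X)) (delta e : R) : 0 < e ->
    e < BPB_modulus_on D delta ->
  exists x f, [/\ D (x, f), 1 - delta < f x & far e x f].
Proof.
move=> e0; rewrite ltNge => /negP Pe.
apply: contrapT => nf; apply/Pe/BPB_modulus_on_le => // x f xf dfx.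
by apply: not_far => fr; apply: nf; exists x, f.
Qed.

Lemma BPB_modulus_le_sqrt eps : 0 < eps < 1 ->
  BPB_modulus X (eps ^+ 2 / 2) <= eps.
Proof.
move=> eps01; have /andP[eps0 _] := eps01.
by apply: BPB_modulus_on_le => // x f [x1 f1]; exact: exists_near_norming_pair.
Qed.

Lemma spherical_BPB_modulus_le_BPB_modulus eps : 0 < eps < 1 ->
  spherical_BPB_modulus X (eps ^+ 2 / 2) <= BPB_modulus X (eps ^+ 2 / 2).
Proof.
move=> eps01; have /andP[eps0 _] := eps01.
apply: lb_le_inf.
  (* The lower-bound argument for [inf] needs a nonempty set; eps is admissible. *)
  by exists eps; split=> // x f [x1 f1]; exact: exists_near_norming_pair.
move=> e [e0 De]; apply: BPB_modulus_on_le => // x f [/= x1 f1].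
by apply: De; split; rewrite /unit_ball/= ?x1 ?f1.
Qed.

Lemma BPB_modulus_sphere_far eps : 0 < eps < 1 ->
    BPB_modulus X (eps ^+ 2 / 2) = eps ->
  forall e, e < eps -> exists x f,
    [/\ `|x| = 1, `|f| = 1, 1 - eps ^+ 2 / 2 < f x & far e x f].
Proof.
move=> eps01 Peps; apply: sphere_far => // e /andP[e0 e_eps].
have [|x [f [[x1 f1] fx xf]]] :=
    @lt_BPB_modulus_on (unit_ball X `*` unit_ball (topdual X)) (eps ^+ 2 / 2) e e0.
  by rewrite -/(BPB_modulus X _) Peps.
by exists x, f.
Qed.

Lemma sphere_far_spherical_BPB_modulus eps : 0 < eps < 1 ->
    (forall e, e < eps -> exists x f,
      [/\ `|x| = 1, `|f| = 1, 1 - eps ^+ 2 / 2 < f x & far e x f]) ->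
  eps <= spherical_BPB_modulus X (eps ^+ 2 / 2).
Proof.
move=> eps01 fars; have /andP[eps0 _] := eps01.
apply: lb_le_inf.
  exists eps; split=> // x f [/= x1 f1].
  by apply: exists_near_norming_pair => //; rewrite ?x1 ?f1.
move=> e [_ De]; rewrite leNgt; apply/negP => /fars[x [f [x1 f1 fx xf]]].
have [//|y [g [yg xy fg]]] := De x f _ fx.
by have := xf _ _ yg xy; rewrite leNgt fg.
Qed.

End Moduli.

Unset Implicit Arguments.

Theorem theorem5p9 (R : realType) (X : completeNormedModType R)
    (Xinf : infinite_dimensional X) :
  (forall delta : R, 0 < delta < 2^-1 ->
     (BPB_modulus X delta = Num.sqrt (2 * delta) <->
      spherical_BPB_modulus X delta = Num.sqrt (2 * delta))) /\
  ((exists2 delta : R, 0 < delta < 2^-1 &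
      BPB_modulus X delta = Num.sqrt (2 * delta)) ->
   almost_isometric_copies (topdual X) 'rV[R]_2 /\
   almost_isometric_copies X 'rV[R]_2).
Proof.
split=> [delta /sqrt2_bounds|[delta /sqrt2_bounds]];
  move: (Num.sqrt _) => eps [eps01 ->].
(* The spherical modulus is at most the ball modulus, itself at most eps. So spherical equality
   forces the other, and the converse passes through far pairs on the spheres. *)
- have le_eps := BPB_modulus_le_sqrt X eps01.
  have S_le := spherical_BPB_modulus_le_BPB_modulus X eps01.
  split=> [Peps|Seps]; apply/eqP; rewrite eq_le.
    rewrite (le_trans S_le le_eps)/=.
    exact/sphere_far_spherical_BPB_modulus/BPB_modulus_sphere_far.
  by rewrite le_eps -{1}Seps.
- move=> /(BPB_modulus_sphere_far eps01)/(sphere_far_almost_square eps01) sq.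
  split; apply: almost_square_copies => //.
  exact: almost_square_predual.
Qed.
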